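(* Let $m\ge1$, $0<q<1$. On $\mathscr P_m$ define $$Q_z=\mathcal Z A_q^\#\mathcal D_q,\quad \Pi_z=I-Q_z,\qquad Q_w=\mathcal Z^\dagger B_q^\#\mathcal D_q^\dagger,\quad \Pi_w=I-Q_w.$$ Then $\Pi_z,Q_z$ and $\Pi_w,Q_w$ are pairs of complementary idempotents. On every sector $\mathscr P_{r,s}^n$, $$\operatorname{im}\Pi_z=\ker\mathcal D_q,\quad \operatorname{im}Q_z=\operatorname{im}\mathcal Z,\qquad \operatorname{im}\Pi_w=\ker\mathcal D_q^\dagger,\quad \operatorname{im}Q_w=\operatorname{im}\mathcal Z^\dagger .$$ Consequently, for all $r,s\ge0$ and $0\le n\le m$, $$\mathscr P_{r,s}^n=\bigl(\ker\mathcal D_q\cap\mathscr P_{r,s}^n\bigr)\oplus\mathcal Z\bigl(\ker\mathcal D_q\cap\mathscr P_{r-1,s}^{n+1}\bigr),$$ $$\mathscr P_{r,s}^n=\bigl(\ker\mathcal D_q^\dagger\cap\mathscr P_{r,s}^n\bigr)\oplus\mathcal Z^\dagger\bigl(\ker\mathcal D_q^\dagger\cap\mathscr P_{r,s-1}^{n-1}\bigr).$$ For the Jackson–Fischer inner product these decompositions are orthogonal and the four operators $\Pi_z,Q_z,\Pi_w,Q_w$ are self-adjoint.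
   Context: $[r]_q=\frac{1-q^r}{1-q}$, $[r]_q!=\prod_{k=1}^r[k]_q$, $[\alpha]_q!=\prod_i[\alpha_i]_q!$. $\mathscr P_m=\mathbb C[z_1,\dots,z_m,w_1,\dots,w_m]\otimes\bigwedge\mathbb C^m$ with basis $z^\alpha w^\beta e_S$ ($\alpha,\beta\in\mathbb N_0^m$, $S\subseteq\{1,\dots,m\}$). $\mathscr P_{r,s}^n$ is the span of those with $|\alpha|=r$, $|\beta|=s$, $|S|=n$ (zero if a degree is negative or $n\notin\{0,\dots,m\}$); on this sector $\operatorname{im}\mathcal Z$ means $\mathcal Z\mathscr P_{r-1,s}^{n+1}$ and $\operatorname{im}\mathcal Z^\dagger$ means $\mathcal Z^\dagger\mathscr P_{r,s-1}^{n-1}$. $D_{q,x}f=\frac{f(\dots,qx,\dots)-f(\dots,x,\dots)}{(q-1)x}$; $\varepsilon_i$ is exterior multiplication by the $i$-th basis vector, $\iota_i=\varepsilon_i^*$ contraction. $\mathcal D_q=\sum_i\varepsilon_iD_{q,z_i}$, $\mathcal D_q^\dagger=\sum_i\iota_iD_{q,w_i}$, $\mathcal Z=\sum_i\iota_iz_i$, $\mathcal Z^\dagger=\sum_i\varepsilon_iw_i$. The operators $A_q=\mathcal D_q\mathcal Z+\mathcal Z\mathcal D_q$ and $B_q=\mathcal D_q^\dagger\mathcal Z^\dagger+\mathcal Z^\dagger\mathcal D_q^\dagger$ are diagonal in the basis $z^\alpha w^\beta e_S$ with eigenvalues $\sum_i[\alpha_i+\mathbf 1_{i\in S}]_q$ and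 $\sum_i[\beta_i+1-\mathbf 1_{i\in S}]_q$; $A_q^\#,B_q^\#$ are the diagonal generalized inverses obtained by inverting every positive eigenvalue and keeping eigenvalue zero as zero. The Jackson–Fischer inner product makes the basis orthogonal with $\|z^\alpha w^\beta e_S\|^2=[\alpha]_q!\,[\beta]_q!$. *)

(* Defs.v *)
From HB Require Import structures.
From mathcomp Require Import all_boot all_order all_algebra.
From mathcomp Require Import classical_sets reals complex mpoly.

Set Implicit Arguments.
Unset Strict Implicit.
Unset Printing Implicit Defensive.

Import Order.TTheory GRing.Theory Num.Theory.

Local Open Scope ring_scope.

Section QNumbers.
Variables (F : fieldType) (q : F).

Definition qint (r : nat) : F := (1 - q ^+ r) / (1 - q).

Definition qfact (r : nat) : F := \prod_(1 <= k < r.+1) qint k.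

Definition mqfact (m : nat) (a : 'X_{1..m}) : F := \prod_i qfact (a i).

End QNumbers.

Section QDerivative.
Variables (F : fieldType) (n : nat) (q : F) (k : 'I_n).
Implicit Types p : {mpoly F[n]}.

(* p(.., q x_k, ..) *)
Definition dilate p : {mpoly F[n]} :=
  p \mPo [tuple if j == k then q *: 'X_j else 'X_j | j < n].

(* Quotient of p by 'X_k. Monomials free of 'X_k are discarded; there are none
   in dilate p - p, so the division in qder is exact (qderP). *)
Definition mdivX p : {mpoly F[n]} :=
  \sum_(mu <- msupp p | (0 < mu k)%N) p@_mu *: 'X_[(mu - U_(k))%MM].

Definition mulX p : {mpoly F[n]} := 'X_k * p.

Definition qder p : {mpoly F[n]} := (q - 1)^-1 *: mdivX (dilate p - p).

Lemma dilateX (mu : 'X_{1..n}) : dilate 'X_[mu] = q ^+ mu k *: 'X_[mu].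
Proof.
rewrite /dilate comp_mpolyX.
have -> : \prod_(i < n) tnth [tuple if j == k then q *: 'X_j else 'X_j | j < n]
            i ^+ mu i
   = \prod_(i < n) ((if i == k then q ^+ mu k else 1) *: 'X_i ^+ mu i)
       :> {mpoly F[n]}.
  apply: eq_bigr => i _; rewrite tnth_mktuple.
  by case: eqP => [->|_]; rewrite ?exprZn ?scale1r.
by rewrite scaler_prod -big_mkcond /= big_pred1_eq -mpolyXE_id.
Qed.

Lemma mcoeff_dilate p mu : (dilate p)@_mu = q ^+ mu k * p@_mu.
Proof.
rewrite /dilate comp_mpolyEX linear_sum /=.
rewrite [p in RHS]mpolyE linear_sum mulr_sumr /=.
apply: eq_bigr => nu _; rewrite -/(dilate _) dilateX.
rewrite !mcoeffZ !mcoeffX; case: eqP => [->|_]; last by rewrite !mulr0.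
by rewrite !mulr1 mulrC.
Qed.

Lemma mcoeff_mdivX p mu : (mdivX p)@_mu = p@_(mu + U_(k)).
Proof.
rewrite /mdivX linear_sum /= [p in RHS]mpolyE linear_sum /= big_mkcond /=.
apply: eq_bigr => nu _; rewrite !mcoeffZ !mcoeffX.
case: (ltnP 0 (nu k)) => hk.
  have le1 : (U_(k) <= nu)%MM by rewrite lep1mP -lt0n.
  congr (_ * _%:R); congr nat_of_bool.
  by apply/eqP/eqP => [<-|->]; rewrite ?submK ?addmK.
case: eqP => [e|_]; last by rewrite mulr0.
by move: hk; rewrite e mnmDE mnm1E eqxx addn1.
Qed.

Lemma mcoeffXUM p mu :
  ('X_k * p)@_mu = if mu k == 0%N then 0 else p@_(mu - U_(k)).
Proof.
case: eqP => [hk|/eqP hk]; last first.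
  have le1 : (U_(k) <= mu)%MM by rewrite lep1mP.
  by rewrite -{1}(submK le1) addmC mulrC mcoeffMX.
rewrite (mpolyE p) mulr_sumr linear_sum big1 //= => nu _.
rewrite -scalerAr -mpolyXD mcoeffZ mcoeffX; case: eqP => [e|_]; last first.
  by rewrite mulr0.
by move: hk; rewrite -e mnmDE mnm1E eqxx.
Qed.

Lemma mcoeff_qder p mu :
  (qder p)@_mu = qint q (mu k).+1 * p@_(mu + U_(k)).
Proof.
rewrite /qder mcoeffZ mcoeff_mdivX mcoeffB mcoeff_dilate mnmDE mnm1E eqxx addn1.
rewrite -{2}[p@__]mul1r -mulrBl mulrA; congr (_ * _).
by rewrite /qint -[q - 1]opprB -[q ^+ _ - 1]opprB invrN mulrNN mulrC.
Qed.

Lemma qderP p : q != 1 -> (q - 1) *: ('X_k * qder p) = dilate p - p.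
Proof.
rewrite -subr_eq0 => q10; apply/mpolyP => mu.
rewrite /qder -scalerAr scalerA mulfV // scale1r mcoeffXUM mcoeff_mdivX.
case: eqP => [hk|/eqP hk]; last by rewrite submK // lep1mP.
by rewrite mcoeffB mcoeff_dilate hk mul1r subrr.
Qed.

Lemma qder_is_linear : linear qder.
Proof.
move=> a p r; apply/mpolyP => mu.
rewrite !(mcoeffD, mcoeffZ, mcoeff_qder) mulrDr; congr (_ + _).
by rewrite mulrCA.
Qed.

HB.instance Definition _ :=
  GRing.isLinear.Build F {mpoly F[n]} {mpoly F[n]} *:%R qder qder_is_linear.

Lemma mulX_is_linear : linear mulX.
Proof. by move=> a p r; rewrite /mulX mulrDr scalerAr. Qed.

HB.instance Definition _ :=
  GRing.isLinear.Build F {mpoly F[n]} {mpoly F[n]} *:%R mulX mulX_is_linear.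

End QDerivative.

(* The element \sum_S f S (x) e_S of F[z, w] (x) /\ F^m. Among the m + m
   variables, z_i is 'X_(lshift m i) and w_i is 'X_(rshift m i). *)
Notation pspace F m := {ffun {set 'I_m} -> {mpoly F[m + m]}}.

Section Operators.
Variables (F : fieldType) (m : nat).
Implicit Types (f : pspace F m) (S : {set 'I_m}) (mu : 'X_{1..(m + m)}).

Definition zexp mu : 'X_{1..m} := [multinom mu (lshift m i) | i < m].
Definition wexp mu : 'X_{1..m} := [multinom mu (rshift m i) | i < m].

(* z^alpha w^beta e_S with alpha = zexp mu and beta = wexp mu *)
Definition basis mu S : pspace F m := [ffun T => if T == S then 'X_[mu] else 0].

(* The sign in e_i /\ e_(S :\ i) = +/- e_S when i \in S. *)
Definition esign (i : 'I_m) S : F := (-1) ^+ #|[set j in S | (j < i)%N]|.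

Definition ext (i : 'I_m) f : pspace F m :=
  [ffun S : {set 'I_m} => if i \in S then esign i S *: f (S :\ i) else 0].

Definition ctr (i : 'I_m) f : pspace F m :=
  [ffun S : {set 'I_m} => if i \in S then 0 else esign i (i |: S) *: f (i |: S)].

Definition pact (T : {mpoly F[m + m]} -> {mpoly F[m + m]}) f : pspace F m :=
  [ffun S => T (f S)].

Definition Dq (q : F) f : pspace F m :=
  \sum_i ext i (pact (qder q (lshift m i)) f).
Definition Dq_dag (q : F) f : pspace F m :=
  \sum_i ctr i (pact (qder q (rshift m i)) f).
Definition Zop f : pspace F m :=
  \sum_i ctr i (pact (mulX (lshift m i)) f).
Definition Zop_dag f : pspace F m :=
  \sum_i ext i (pact (mulX (rshift m i)) f).

Definition Aq (q : F) f : pspace F m := Dq q (Zop f) + Zop (Dq q f).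
Definition Bq (q : F) f : pspace F m :=
  Dq_dag q (Zop_dag f) + Zop_dag (Dq_dag q f).

Definition diagop (lam : 'X_{1..(m + m)} -> {set 'I_m} -> F) f : pspace F m :=
  [ffun S => \sum_(mu <- msupp (f S)) (lam mu S * (f S)@_mu) *: 'X_[mu]].

Definition eigA (q : F) mu S : F :=
  \sum_i qint q (zexp mu i + (i \in S)).
Definition eigB (q : F) mu S : F :=
  \sum_i qint q (wexp mu i + 1 - (i \in S)).

(* Aq and Bq are diagonal with eigenvalues eigA and eigB (Aq_diag, Bq_diag);
   zero eigenvalues stay zero below since 0^-1 = 0. *)
Definition Aq_pinv (q : F) := diagop (fun mu S => (eigA q mu S)^-1).
Definition Bq_pinv (q : F) := diagop (fun mu S => (eigB q mu S)^-1).

Definition Qz (q : F) f : pspace F m := Zop (Aq_pinv q (Dq q f)).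
Definition Pz (q : F) f : pspace F m := f - Qz q f.
Definition Qw (q : F) f : pspace F m := Zop_dag (Bq_pinv q (Dq_dag q f)).
Definition Pw (q : F) f : pspace F m := f - Qw q f.

Lemma ext_is_linear i : linear (ext i).
Proof.
move=> a f g; apply/ffunP => S; rewrite !ffunE; case: ifP => _.
  by rewrite scalerDr !scalerA mulrC.
by rewrite scaler0 addr0.
Qed.

HB.instance Definition _ i :=
  GRing.isLinear.Build F (pspace F m) (pspace F m) *:%R (ext i)
    (ext_is_linear i).

Lemma ctr_is_linear i : linear (ctr i).
Proof.
move=> a f g; apply/ffunP => S; rewrite !ffunE; case: ifP => _.
  by rewrite scaler0 addr0.
by rewrite scalerDr !scalerA mulrC.
Qed.

HB.instance Definition _ i :=
  GRing.isLinear.Build F (pspace F m) (pspace F m) *:%R (ctr i)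
    (ctr_is_linear i).

Lemma pact_is_linear (T : {linear {mpoly F[m + m]} -> {mpoly F[m + m]}}) :
  linear (pact T).
Proof. by move=> a f g; apply/ffunP => S; rewrite !ffunE linearP. Qed.

HB.instance Definition _
    (T : {linear {mpoly F[m + m]} -> {mpoly F[m + m]}}) :=
  GRing.isLinear.Build F (pspace F m) (pspace F m) *:%R (pact T)
    (pact_is_linear T).

Lemma mcoeff_diagop lam f S mu :
  (diagop lam f S)@_mu = lam mu S * (f S)@_mu.
Proof.
rewrite ffunE linear_sum /= [f S in RHS]mpolyE linear_sum mulr_sumr /=.
apply: eq_bigr => nu _; rewrite !mcoeffZ mcoeffX.
by case: eqP => [->|_]; rewrite ?mulr1 ?mulr0.
Qed.

Lemma diagop_basis lam mu S : diagop lam (basis mu S) = lam mu S *: basis mu S.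
Proof.
apply/ffunP => T; apply/mpolyP => nu; rewrite mcoeff_diagop !ffunE.
case: eqP => [->|_]; last by rewrite scaler0 mcoeff0 mulr0.
by rewrite mcoeffZ mcoeffX; case: eqP => [->|_]; rewrite ?mulr0.
Qed.

Lemma ext_pact i (T : {linear {mpoly F[m + m]} -> {mpoly F[m + m]}}) f :
  ext i (pact T f) = pact T (ext i f).
Proof.
by apply/ffunP => S; rewrite !ffunE; case: ifP; rewrite ?linear0 // linearZ.
Qed.

Lemma ctr_pact i (T : {linear {mpoly F[m + m]} -> {mpoly F[m + m]}}) f :
  ctr i (pact T f) = pact T (ctr i f).
Proof.
by apply/ffunP => S; rewrite !ffunE; case: ifP; rewrite ?linear0 // linearZ.
Qed.

Lemma ext_qder i q k f : ext i (pact (qder q k) f) = pact (qder q k) (ext i f).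
Proof. exact: ext_pact. Qed.

Lemma ctr_qder i q k f : ctr i (pact (qder q k) f) = pact (qder q k) (ctr i f).
Proof. exact: ctr_pact. Qed.

Lemma ext_mulX i k f : ext i (pact (mulX k) f) = pact (mulX k) (ext i f).
Proof. exact: ext_pact. Qed.

Lemma ctr_mulX i k f : ctr i (pact (mulX k) f) = pact (mulX k) (ctr i f).
Proof. exact: ctr_pact. Qed.

Lemma esignM i S : esign i S * esign i S = 1.
Proof. by rewrite /esign -expr2 sqrr_sign. Qed.

Lemma ext_ctr i f S : ext i (ctr i f) S = if i \in S then f S else 0.
Proof.
rewrite !ffunE; case: ifP => // iS.
by rewrite !inE eqxx /= finset.setD1K // scalerA esignM scale1r.
Qed.

Lemma ctr_ext i f S : ctr i (ext i f) S = if i \in S then 0 else f S.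
Proof.
rewrite !ffunE; case: ifP => // /negbT iS.
by rewrite finset.setU11 finset.setU1K // scalerA esignM scale1r.
Qed.

Lemma esignU i j S : i != j -> j \notin S ->
  esign i (j |: S) = (-1) ^+ (j < i)%N * esign i S.
Proof.
move=> ij jS; rewrite /esign -exprD; congr (_ ^+ _).
case: (ltnP j i) => ji; last first.
  rewrite add0n; congr #|pred_of_set _|; apply/finset.setP => x; rewrite !inE.
  by case: (eqVneq x j) => // ->; rewrite ltnNge ji andbF (negbTE jS).
rewrite (_ : [set _ in _ | _] = j |: [set x in S | (x < i)%N]).
  by rewrite cardsU1 !inE (negbTE jS).
apply/finset.setP => x; rewrite !inE; case: (eqVneq x j) => // ->.
by rewrite ji.
Qed.

Lemma ext_ctr_anti i j f : i != j -> ext i (ctr j f) + ctr j (ext i f) = 0.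
Proof.
move=> ij; apply/ffunP => S; rewrite !ffunE !inE (negbTE ij) /=.
rewrite [j == i]eq_sym (negbTE ij) /=.
case iS: (i \in S); case jS: (j \in S);
  rewrite ?scaler0 ?addr0 ?add0r //.
have -> : (j |: S) :\ i = j |: (S :\ i).
  apply/finset.setP => x; rewrite !inE; case: (eqVneq x i) => // ->.
  by rewrite (negbTE ij).
rewrite !scalerA -scalerDl.
have -> : esign i (j |: S) = (-1) ^+ (j < i)%N * esign i S.
  by rewrite esignU // jS.
have -> : esign j (j |: S) = (-1) ^+ (i < j)%N * esign j (j |: S :\ i).
  rewrite -{1}(finset.setD1K iS) finset.setUCA esignU //; last 2 first.
  - by rewrite eq_sym.
  - by rewrite !inE eqxx (negbTE ij).
have -> : ((i < j) = ~~ (j < i))%N.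
  have ijn : (i : nat) != j by rewrite (inj_eq (@ord_inj _)).
  by rewrite -leqNgt ltn_neqAle ijn.
case: (j < i)%N; rewrite /= ?expr0 ?expr1 ?mul1r ?mulN1r ?mulrN ?mulNr.
  by rewrite [X in _ - X]mulrC subrr scale0r.
by rewrite [X in _ - X]mulrC subrr scale0r.
Qed.

Lemma pactM (T U : {mpoly F[m + m]} -> {mpoly F[m + m]}) f :
  pact T (pact U f) = pact (T \o U) f.
Proof. by apply/ffunP => S; rewrite !ffunE. Qed.

Lemma qderXM (q : F) (k l : 'I_(m + m)) p : k != l ->
  qder q k ('X_l * p) = 'X_l * qder q k p.
Proof.
move=> kl; apply/mpolyP => mu; rewrite mcoeff_qder !mcoeffXUM.
rewrite mnmDE mnm1E (negbTE kl) addn0; case: eqP => [_|/eqP h].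
  by rewrite mulr0.
rewrite mcoeff_qder mnmBE mnm1E [l == k]eq_sym (negbTE kl) subn0.
congr (_ * _@__); apply/mnmP => i; rewrite !(mnmDE, mnmBE) !mnm1E.
case: (eqVneq k i) => [<-|_]; last by rewrite !addn0.
by rewrite eq_sym (negbTE kl) !subn0.
Qed.

Lemma mcoeff_qderX (q : F) (k : 'I_(m + m)) p mu :
  (qder q k ('X_k * p))@_mu = qint q (mu k).+1 * p@_mu.
Proof.
by rewrite mcoeff_qder mcoeffXUM mnmDE mnm1E eqxx addn1 /= addmK.
Qed.

Lemma mcoeffX_qder (q : F) (k : 'I_(m + m)) p mu :
  ('X_k * qder q k p)@_mu = qint q (mu k) * p@_mu.
Proof.
rewrite mcoeffXUM; case: eqP => [->|/eqP h].
  by rewrite /qint subrr mul0r mul0r.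
rewrite mcoeff_qder mnmBE mnm1E eqxx subn1 prednK ?lt0n // submK //.
by rewrite lep1mP.
Qed.

Lemma Aq_diag (q : F) f : Aq q f = diagop (eigA q) f.
Proof.
have -> : Aq q f =
    \sum_i (ext i (ctr i (pact (qder q (lshift m i))
                              (pact (mulX (lshift m i)) f)))
                + ctr i (ext i (pact (mulX (lshift m i))
                              (pact (qder q (lshift m i)) f)))).
  rewrite /Aq /Dq /Zop.
  under eq_bigr => i _ do rewrite !linear_sum /=.
  under [X in _ + X]eq_bigr => j _ do rewrite !linear_sum /=.
  rewrite [X in _ + X]exchange_big /= -big_split; apply: eq_bigr => i _ /=.
  rewrite -big_split /= (bigD1 i) //= [X in _ + X]big1 ?addr0.
    by rewrite -ctr_qder -ext_mulX.
  move=> j ji; rewrite -ctr_qder -ext_mulX !pactM.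
  rewrite (_ : pact (mulX _ \o qder _ _) f =
    pact (qder q (lshift m i) \o mulX (lshift m j)) f).
    by rewrite ext_ctr_anti // eq_sym.
  apply/ffunP => S; rewrite !ffunE /= /mulX qderXM // (inj_eq (@lshift_inj _ _)).
  by rewrite eq_sym.
apply/ffunP => S; apply/mpolyP => mu; rewrite mcoeff_diagop.
rewrite sum_ffunE linear_sum /eigA mulr_suml /=.
apply: eq_bigr => i _; rewrite ffunE ext_ctr ctr_ext !ffunE mnmE.
by case: (i \in S);
  rewrite mcoeffD mcoeff0 ?addr0 ?add0r ?addn1 ?addn0
          ?mcoeff_qderX ?mcoeffX_qder.
Qed.

Lemma Bq_diag (q : F) f : Bq q f = diagop (eigB q) f.
Proof.
have -> : Bq q f =
    \sum_i (ctr i (ext i (pact (qder q (rshift m i))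
                              (pact (mulX (rshift m i)) f)))
                + ext i (ctr i (pact (mulX (rshift m i))
                              (pact (qder q (rshift m i)) f)))).
  rewrite /Bq /Dq_dag /Zop_dag.
  under eq_bigr => i _ do rewrite !linear_sum /=.
  under [X in _ + X]eq_bigr => j _ do rewrite !linear_sum /=.
  rewrite [X in _ + X]exchange_big /= -big_split; apply: eq_bigr => i _ /=.
  rewrite -big_split /= (bigD1 i) //= [X in _ + X]big1 ?addr0.
    by rewrite -ext_qder -ctr_mulX.
  move=> j ji; rewrite -ext_qder -ctr_mulX !pactM.
  rewrite (_ : pact (mulX _ \o qder _ _) f =
    pact (qder q (rshift m i) \o mulX (rshift m j)) f).
    by rewrite addrC ext_ctr_anti // eq_sym.
  apply/ffunP => S; rewrite !ffunE /= /mulX qderXM // (inj_eq (@rshift_inj _ _)).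
  by rewrite eq_sym.
apply/ffunP => S; apply/mpolyP => mu; rewrite mcoeff_diagop.
rewrite sum_ffunE linear_sum /eigB mulr_suml /=.
apply: eq_bigr => i _; rewrite ffunE ext_ctr ctr_ext !ffunE mnmE.
by case: (i \in S);
  rewrite mcoeffD mcoeff0 ?addr0 ?add0r ?addnK ?subn0 ?addn1
          ?mcoeff_qderX ?mcoeffX_qder.
Qed.

End Operators.

Local Open Scope classical_set_scope.

Section Sectors.
Variables (F : fieldType) (m : nat).

(* The span in a possibly infinite-dimensional space. *)
Definition linspan (V : lmodType F) (B : set V) : set V :=
  [set v | exists (k : nat) (c : 'I_k -> F) (b : 'I_k -> V),
     (forall i, B (b i)) /\ v = \sum_i c i *: b i].

(* Integer degrees, so that a sector of negative degree is {0}. *)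
Definition sector (r s n : int) : set (pspace F m) :=
  linspan [set f | exists (mu : 'X_{1..(m + m)}) (S : {set 'I_m}),
    [/\ (mdeg (zexp mu))%:Z = r, (mdeg (wexp mu))%:Z = s, #|S|%:Z = n
      & f = basis F mu S]].

End Sectors.

Definition kernel (U V : zmodType) (T : U -> V) : set U := [set u | T u = 0].

Definition complementary_idempotents (V : zmodType) (P Q : V -> V) : Prop :=
  [/\ forall v, P (P v) = P v, forall v, Q (Q v) = Q v,
      forall v, P v + Q v = v, forall v, P (Q v) = 0
    & forall v, Q (P v) = 0].

(* W is the internal direct sum of its subspaces U1 and U2. *)
Definition direct_sum (V : zmodType) (W U1 U2 : set V) : Prop :=
  W = [set u1 + u2 | u1 in U1 & u2 in U2] /\ U1 `&` U2 = [set 0].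

Section JacksonFischer.
Variables (C : numClosedFieldType) (m : nat) (q : C).
Implicit Types (f g : pspace C m) (S : {set 'I_m}) (mu : 'X_{1..(m + m)}).

Definition jf_weight mu : C := mqfact q (zexp mu) * mqfact q (wexp mu).

(* Linear in the first argument, conjugate-linear in the second. *)
Definition jf f g : C :=
  \sum_S \sum_(mu <- msupp (f S)) jf_weight mu * ((f S)@_mu * ((g S)@_mu)^*).

Definition jf_orthogonal (U1 U2 : set (pspace C m)) : Prop :=
  forall u1 u2, U1 u1 -> U2 u2 -> jf u1 u2 = 0.

Definition jf_selfadjoint (T : pspace C m -> pspace C m) : Prop :=
  forall f g, jf (T f) g = jf f (T g).

Lemma jf_basis mu nu S T :
  jf (basis C mu S) (basis C nu T) =
  if (mu == nu) && (S == T) then jf_weight mu else 0.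
Proof.
rewrite /jf (bigD1 S) //= [X in _ + X]big1 => [|U US]; last first.
  by rewrite ffunE (negbTE US) msupp0 big_nil.
rewrite addr0 !ffunE eqxx msuppX big_seq1 mcoeffX eqxx mul1r.
case: (S == T); rewrite ?andbF ?andbT ?mcoeff0 ?rmorph0 ?mulr0 //.
rewrite mcoeffX [nu == _]eq_sym.
by case: (mu == nu); rewrite ?rmorph1 ?rmorph0 ?mulr1 ?mulr0.
Qed.

Lemma jf_ext i f g : jf (ext i f) g = jf f (ctr i g).
Proof.
rewrite /jf (bigID (fun S => i \in S)) /= [X in _ + X]big1 ?addr0; last first.
  by move=> S iS; rewrite ffunE (negbTE iS) msupp0 big_nil.
rewrite [RHS](bigID (fun S => i \in S)) /= [X in X + _]big1 ?add0r; last first.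
  move=> S iS; rewrite big1 // => mu _.
  by rewrite [ctr _ _ _]ffunE iS mcoeff0 rmorph0 !mulr0.
rewrite (reindex_onto (fun S => i |: S) (fun S => S :\ i)) /=; last first.
  by move=> S iS; rewrite finset.setD1K.
apply: eq_big => [S|S /andP[_ /eqP hS]].
  rewrite finset.setU11 /=; apply/eqP/idP => [<-|iS]; last by rewrite finset.setU1K.
  by rewrite !inE eqxx.
have iS : i \notin S by rewrite -hS !inE eqxx.
rewrite !ffunE finset.setU11 hS (negbTE iS); set e := esign _ _ _.
have e0 : e != 0 by rewrite /e /esign signr_eq0.
rewrite (perm_big (msupp (f S))) /=; last exact/msuppZ.
apply: eq_bigr => mu _; rewrite !mcoeffZ rmorphM /=.
by rewrite /e /esign rmorph_sign; congr (_ * _); rewrite mulrCA mulrA.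
Qed.

End JacksonFischer.

(* Main.v *)
Require Import Defs.
From HB Require Import structures.
From mathcomp Require Import all_boot all_order all_algebra.
From mathcomp Require Import classical_sets reals complex mpoly.
From mathcomp Require Import zify.

(** D_q and Z are nilpotent of order two and D_q Z + Z D_q = A_q is diagonal.
    Each monomial of D_q f or Z f comes from monomials of f with the same
    A_q-eigenvalue, so any diagonal operator that is a function of A_q, in
    particular G = A_q^#, commutes with D_q and Z; moreover this eigenvalue is
    positive on im D_q and im Z, so A_q G is the identity there. For Q = Z G D_q
    this gives D_q Q = D_q and Q Z = Z: hence Q is an idempotent with kernel
    ker D_q and image im Z, and f = (f - Q f) + Z (G D_q f) is the
    decomposition. Orthogonality and self-adjointness follow from D_q^* = Z.
    The w-side is the same argument with the roles of exterior multiplication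
    and contraction exchanged. *)

Import Order.TTheory GRing.Theory Num.Theory.

Local Open Scope classical_set_scope.
Local Open Scope complex_scope.
Local Open Scope ring_scope.

Set Implicit Arguments.
Unset Strict Implicit.

(** * Sign rules of the exterior algebra and nilpotency of the four operators *)

Section Nilpotency.
Variables (F : fieldType) (m : nat).
Implicit Types (f : pspace F m) (S : {set 'I_m}) (i j : 'I_m).

(** The two products are the signs of inserting [i] and [j] in either order. An inserted index flips
    the sign of the other one only if it is the smaller, and exactly one of [i < j] and [j < i]
    holds. *)
Lemma esign_swap i j S : i != j -> i \notin S -> j \notin S ->
  esign F i (i |: (j |: S))%SET * esign F j (j |: S)%SET =
  - (esign F j (j |: (i |: S))%SET * esign F i (i |: S)%SET).
Proof.
move=> ij iS jS.
rewrite finset.setUCA (esignU F ij); last by rewrite !inE negb_or jS eq_sym ij.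
rewrite [(j |: (i |: _))%SET]finset.setUCA (@esignU _ _ j i) 1?eq_sym //;
  last by rewrite !inE negb_or iS ij.
have -> : ((i < j) = ~~ (j < i))%N.
  by rewrite -leqNgt ltn_neqAle (inj_eq (@ord_inj _)) ij.
by case: (j < i)%N; rewrite /= ?expr0 ?expr1 ?mul1r ?mulN1r ?mulNr ?opprK
  mulrC.
Qed.

Lemma ext_ext_anti i j f : ext i (ext j f) = - ext j (ext i f).
Proof.
apply/ffunP => S; rewrite !ffunE.
have [->|ij] := eqVneq i j.
  by rewrite !inE eqxx /= scaler0 if_same oppr0.
rewrite !inE ij eq_sym ij /=.
case iS: (i \in S); case jS: (j \in S); rewrite ?scaler0 ?oppr0 //.
(* Both composites evaluate [f] at the same set [T], so only the signs remain to be compared,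
   through [S = i |: (j |: T)]. *)
rewrite !scalerA -scaleNr; set T := (S :\ i :\ j)%SET.
have iT : i \notin T by rewrite !inE eqxx andbF.
have jT : j \notin T by rewrite !inE eqxx.
have -> : (S :\ j :\ i)%SET = T.
  by apply/finset.setP => x; rewrite !inE andbCA.
have Si : (S :\ i)%SET = (j |: T)%SET.
  by rewrite finset.setD1K // !inE eq_sym ij jS.
have Sj : (S :\ j)%SET = (i |: T)%SET.
  apply/finset.setP => x; rewrite !inE.
  by case: (eqVneq x i) => // ->; rewrite ij iS.
rewrite Si Sj -(finset.setD1K iS) Si esign_swap //.
by congr (- (esign _ _ _ * _) *: _); rewrite finset.setUCA.
Qed.

Lemma ctr_ctr_anti i j f : ctr i (ctr j f) = - ctr j (ctr i f).
Proof.
apply/ffunP => S; rewrite !ffunE.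
have [->|ij] := eqVneq i j.
  by rewrite !inE eqxx /= scaler0 if_same oppr0.
rewrite !inE (negbTE ij) eq_sym (negbTE ij) /=.
case iS: (i \in S); case jS: (j \in S); rewrite ?scaler0 ?oppr0 //.
rewrite !scalerA -scaleNr; congr (_ *: _); last first.
  by congr (fun_of_fin _ _); rewrite finset.setUCA.
rewrite mulrC [X in - X]mulrC -esign_swap ?iS ?jS //; last by rewrite eq_sym.
Qed.

(** Exchanging the two summations turns the sum into its own opposite; invertibility of 2 then
    forces it to vanish, diagonal terms included. *)
Lemma sum_anti_eq0 (V : lmodType F) (a : 'I_m -> 'I_m -> V) :
  (2%:R : F) != 0 ->
  (forall i j, a i j = - a j i) -> \sum_i \sum_j a i j = 0.
Proof.
move=> two0 anti; set s := LHS.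
have : s = - s.
  rewrite {1}/s exchange_big /= /s -sumrN; apply: eq_bigr => i _.
  by rewrite -sumrN; apply: eq_bigr => j _; exact: anti.
move/eqP; rewrite -subr_eq0 opprK -mulr2n -scaler_nat scaler_eq0 (negbTE two0).
by move/eqP.
Qed.

Lemma Dq_is_linear q : linear (@Dq F m q).
Proof.
move=> a f g; rewrite /Dq scaler_sumr -big_split; apply: eq_bigr => i _ /=.
by rewrite !linearP.
Qed.

HB.instance Definition _ q :=
  GRing.isLinear.Build F (pspace F m) (pspace F m) *:%R (@Dq F m q)
    (Dq_is_linear q).

Lemma Dq_dag_is_linear q : linear (@Dq_dag F m q).
Proof.
move=> a f g; rewrite /Dq_dag scaler_sumr -big_split; apply: eq_bigr => i _ /=.
by rewrite !linearP.
Qed.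

HB.instance Definition _ q :=
  GRing.isLinear.Build F (pspace F m) (pspace F m) *:%R (@Dq_dag F m q)
    (Dq_dag_is_linear q).

Lemma Zop_is_linear : linear (@Zop F m).
Proof.
move=> a f g; rewrite /Zop scaler_sumr -big_split; apply: eq_bigr => i _ /=.
by rewrite !linearP.
Qed.

HB.instance Definition _ :=
  GRing.isLinear.Build F (pspace F m) (pspace F m) *:%R (@Zop F m)
    Zop_is_linear.

Lemma Zop_dag_is_linear : linear (@Zop_dag F m).
Proof.
move=> a f g; rewrite /Zop_dag scaler_sumr -big_split; apply: eq_bigr => i _ /=.
by rewrite !linearP.
Qed.

HB.instance Definition _ :=
  GRing.isLinear.Build F (pspace F m) (pspace F m) *:%R (@Zop_dag F m)
    Zop_dag_is_linear.

Lemma mcoeff_lincomb (a : F) f g S mu :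
  ((a *: f + g) S)@_mu = a * (f S)@_mu + (g S)@_mu.
Proof. by rewrite !ffunE mcoeffD mcoeffZ. Qed.

Lemma diagop_is_linear lam : linear (@diagop F m lam).
Proof.
move=> a f g; apply/ffunP => S; apply/mpolyP => mu.
rewrite mcoeff_lincomb !mcoeff_diagop mcoeff_lincomb.
by rewrite mulrDr mulrCA.
Qed.

HB.instance Definition _ lam :=
  GRing.isLinear.Build F (pspace F m) (pspace F m) *:%R (@diagop F m lam)
    (diagop_is_linear lam).

Lemma pact_comm (T U : {mpoly F[m + m]} -> {mpoly F[m + m]}) f :
  (forall p, T (U p) = U (T p)) -> pact T (pact U f) = pact U (pact T f).
Proof. by move=> TU; apply/ffunP => S; rewrite !ffunE. Qed.

Lemma qder_comm q (k l : 'I_(m + m)) p :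
  qder q k (qder q l p) = qder q l (qder q k p) :> {mpoly F[m + m]}.
Proof.
have [->|kl] := eqVneq k l; first by [].
apply/mpolyP => mu; rewrite !mcoeff_qder !mnmDE !mnm1E (negbTE kl).
by rewrite eq_sym (negbTE kl) !addn0 mulrCA -!addmA [(U_(k) + _)%MM]addmC.
Qed.

Lemma mulX_comm (k l : 'I_(m + m)) p :
  mulX k (mulX l p) = mulX l (mulX k p) :> {mpoly F[m + m]}.
Proof. exact: mulrCA. Qed.

Hypothesis two0 : (2%:R : F) != 0.

(** The q-derivatives commute and the exterior multiplications anticommute, so the double sum is
    antisymmetric. The next three lemmas follow the same pattern. *)
Lemma Dq_nilp q f : Dq q (Dq q f) = 0.
Proof.
rewrite /Dq; under eq_bigr => i _ do rewrite !linear_sum /=.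
apply: sum_anti_eq0 => // i j; rewrite -!ext_qder ext_ext_anti.
by rewrite (pact_comm _ (qder_comm q _ _)).
Qed.

Lemma Dq_dag_nilp q f : Dq_dag q (Dq_dag q f) = 0.
Proof.
rewrite /Dq_dag; under eq_bigr => i _ do rewrite !linear_sum /=.
apply: sum_anti_eq0 => // i j; rewrite -!ctr_qder ctr_ctr_anti.
by rewrite (pact_comm _ (qder_comm q _ _)).
Qed.

Lemma Zop_nilp f : Zop (Zop f) = 0.
Proof.
rewrite /Zop; under eq_bigr => i _ do rewrite !linear_sum /=.
apply: sum_anti_eq0 => // i j; rewrite -!ctr_mulX ctr_ctr_anti.
by rewrite (pact_comm _ (mulX_comm _ _)).
Qed.

Lemma Zop_dag_nilp f : Zop_dag (Zop_dag f) = 0.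
Proof.
rewrite /Zop_dag; under eq_bigr => i _ do rewrite !linear_sum /=.
apply: sum_anti_eq0 => // i j; rewrite -!ext_mulX ext_ext_anti.
by rewrite (pact_comm _ (mulX_comm _ _)).
Qed.

End Nilpotency.

(** * Locality: operators described by which coefficients they read *)

Section Locality.
Variables (F : fieldType) (m : nat).
Local Notation V := (pspace F m).
Local Notation rel2 := ('X_{1..(m + m)} -> {set 'I_m} ->
  'X_{1..(m + m)} -> {set 'I_m} -> Prop).
Implicit Types (f : V) (S U : {set 'I_m}) (mu nu : 'X_{1..(m + m)}).

(* The coefficient of [T f] at (mu, S) only depends on the coefficients of [f]
   at the indices related to (mu, S) by [r]. *)
Definition local (r : rel2) (T : V -> V) : Prop :=
  forall f mu S, (forall nu U, r mu S nu U -> (f U)@_nu = 0) ->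
    (T f S)@_mu = 0.

Definition conv (r : rel2) : rel2 := fun mu S nu U => r nu U mu S.

(** [(nu, U)] is the source and [(mu, S)] the target of one summand of [Dq]: a factor [z_i] is
    traded for [e_i]. The converse relation describes [Zop]. *)
Definition zstep : rel2 := fun mu S nu U =>
  exists i, [/\ i \notin U, S = (i |: U)%SET & nu = (mu + U_(lshift m i))%MM].

(** The analogue for [Dq_dag], which removes a factor [w_i] together with [e_i]; the converse
    describes [Zop_dag]. *)
Definition wstep : rel2 := fun mu S nu U =>
  exists i, [/\ i \notin S, U = (i |: S)%SET & nu = (mu + U_(rshift m i))%MM].

Lemma local_Dq q : local zstep (@Dq F m q).
Proof.
move=> f mu S f0; rewrite /Dq sum_ffunE linear_sum big1 //= => i _.
rewrite ffunE; case: ifP => iS; last by rewrite mcoeff0.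
rewrite mcoeffZ ffunE mcoeff_qder f0 ?mulr0 //.
by exists i; rewrite !inE eqxx finset.setD1K.
Qed.

Lemma local_Dq_dag q : local wstep (@Dq_dag F m q).
Proof.
move=> f mu S f0; rewrite /Dq_dag sum_ffunE linear_sum big1 //= => i _.
rewrite ffunE; case: ifP => iS; first by rewrite mcoeff0.
rewrite mcoeffZ ffunE mcoeff_qder f0 ?mulr0 //.
by exists i; rewrite iS.
Qed.

Lemma local_Zop : local (conv zstep) (@Zop F m).
Proof.
move=> f mu S f0; rewrite /Zop sum_ffunE linear_sum big1 //= => i _.
rewrite ffunE; case: ifP => iS; first by rewrite mcoeff0.
rewrite mcoeffZ ffunE /mulX mcoeffXUM; case: eqP => [|/eqP mui].
  by rewrite mulr0.
rewrite f0 ?mulr0 //; exists i; rewrite iS submK //.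
by rewrite lep1mP.
Qed.

Lemma local_Zop_dag : local (conv wstep) (@Zop_dag F m).
Proof.
move=> f mu S f0; rewrite /Zop_dag sum_ffunE linear_sum big1 //= => i _.
rewrite ffunE; case: ifP => iS; last by rewrite mcoeff0.
rewrite mcoeffZ ffunE /mulX mcoeffXUM; case: eqP => [|/eqP mui].
  by rewrite mulr0.
rewrite f0 ?mulr0 //; exists i; rewrite !inE eqxx finset.setD1K // submK //.
by rewrite lep1mP.
Qed.

(** On the indices read at [(mu, S)], [diagop lam] acts as the scalar [lam mu S]. Locality is
    therefore applied to the difference of [diagop lam f] and that multiple of [f]. *)
Lemma local_diagop_comm (r : rel2) (T : {linear V -> V}) lam f :
  local r T -> (forall mu S nu U, r mu S nu U -> lam nu U = lam mu S) ->
  T (diagop lam f) = diagop lam (T f).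
Proof.
move=> Tr lamr; apply/ffunP => S; apply/mpolyP => mu; rewrite mcoeff_diagop.
have : (T (- lam mu S *: f + diagop lam f) S)@_mu = 0.
  apply: Tr => nu U /lamr e.
  by rewrite mcoeff_lincomb mcoeff_diagop e mulNr addNr.
by rewrite linearP mcoeff_lincomb mulNr addrC; exact: subr0_eq.
Qed.

(** Where [lam] vanishes no index is related to [(mu, S)], so locality holds vacuously and the
    coefficient of [T f] is already zero; elsewhere [lam] cancels its inverse. *)
Lemma local_diagopK (r : rel2) (T : V -> V) lam f :
  local r T -> (forall mu S nu U, r mu S nu U -> lam mu S != 0) ->
  diagop lam (diagop (fun mu S => (lam mu S)^-1) (T f)) = T f.
Proof.
move=> Tr lamr; apply/ffunP => S; apply/mpolyP => mu; rewrite !mcoeff_diagop.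
have [e|lam0] := eqVneq (lam mu S) 0; last by rewrite mulVKf.
rewrite e mul0r Tr // => nu U /lamr; by rewrite e eqxx.
Qed.

(* Coefficients off [p] vanish. *)
Definition supported (p : 'X_{1..(m + m)} -> {set 'I_m} -> bool) : set V :=
  [set f | forall mu S, ~~ p mu S -> (f S)@_mu = 0].

Lemma local_supported (r : rel2) (T : V -> V)
    (p p' : 'X_{1..(m + m)} -> {set 'I_m} -> bool) f :
  local r T -> (forall mu S nu U, r mu S nu U -> p nu U -> p' mu S) ->
  supported p f -> supported p' (T f).
Proof.
move=> Tr pp' fp mu S pmu; apply: Tr => nu U /pp' h; apply: fp.
by apply: contra pmu => /h.
Qed.

Lemma supported_diagop lam p f : supported p f -> supported p (diagop lam f).
Proof. by move=> fp mu S pmu; rewrite mcoeff_diagop fp // mulr0. Qed.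

Lemma supported_lincomb (a : F) p f g :
  supported p f -> supported p g -> supported p (a *: f + g).
Proof. by move=> fp gp mu S pmu; rewrite mcoeff_lincomb fp // gp // mulr0 addr0.
Qed.

Lemma supported0 p : supported p 0.
Proof. by move=> mu S _; rewrite ffunE mcoeff0. Qed.

End Locality.

(** * Sectors as support conditions, and the effect of a step on degrees and eigenvalues *)

Section Sector.
Variables (F : fieldType) (m : nat).
Implicit Types (f : pspace F m) (S U : {set 'I_m}) (mu nu : 'X_{1..(m + m)}).

Lemma linspan0 (V : lmodType F) (B : set V) : linspan B 0.
Proof.
by exists 0%N, (fun=> 0), (fun=> 0); split=> [[]//|]; rewrite big_ord0.
Qed.

Lemma linspanZ_mem (V : lmodType F) (B : set V) (a : F) v :
  B v -> linspan B (a *: v).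
Proof.
by move=> Bv; exists 1%N, (fun=> a), (fun=> v); split=> //; rewrite big_ord1.
Qed.

Lemma linspanD (V : lmodType F) (B : set V) u v :
  linspan B u -> linspan B v -> linspan B (u + v).
Proof.
move=> [k [c [b [Bb ->]]]] [l [d [e [Be ->]]]].
exists (k + l)%N,
  (fun i => match split i with inl j => c j | inr j => d j end),
  (fun i => match split i with inl j => b j | inr j => e j end).
split=> [i|]; first by case: (split i).
rewrite big_split_ord; congr (_ + _); apply: eq_bigr => i _.
  by rewrite (unsplitK (inl i)).
by rewrite (unsplitK (inr i)).
Qed.

Lemma linspan_sum (V : lmodType F) (B : set V) (I : Type) (s : seq I)
    (P : pred I) (v : I -> V) :
  (forall i, P i -> linspan B (v i)) -> linspan B (\sum_(i <- s | P i) v i).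
Proof. by move=> Bv; apply: big_ind Bv => //; [exact: linspan0|exact: linspanD].
Qed.

Definition in_degree (r s n : int) mu S : bool :=
  [&& (mdeg (zexp mu))%:Z == r, (mdeg (wexp mu))%:Z == s & #|S|%:Z == n].

Lemma basis_expansion f :
  f = \sum_S \sum_(mu <- msupp (f S)) (f S)@_mu *: Defs.basis F mu S.
Proof.
apply/ffunP => T; rewrite sum_ffunE (bigD1 T) //= [X in _ + X]big1 => [|S ST].
  rewrite addr0 sum_ffunE [LHS]mpolyE; apply: eq_bigr => mu _.
  by rewrite !ffunE eqxx.
rewrite sum_ffunE big1 // => mu _.
by rewrite !ffunE eq_sym (negbTE ST) scaler0.
Qed.

(** Replaces membership in a span by vanishing of coefficients, the form in which locality applies.
    A negative degree makes [in_degree] false everywhere, which leaves only 0. *)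
Lemma sectorE r s n : @sector F m r s n = supported (in_degree r s n).
Proof.
apply/seteqP; split=> f.
  move=> [k [c [b [Bb ->]]]] mu S off; rewrite sum_ffunE linear_sum big1 //=.
  move=> i _; rewrite ffunE mcoeffZ; have [nu [T [zr ws Tn ->]]] := Bb i.
  rewrite ffunE; case: eqP => [ST|_]; last by rewrite mcoeff0 mulr0.
  rewrite mcoeffX; case: eqP => [nm|_]; last by rewrite mulr0.
  by move: off; rewrite /in_degree -nm ST zr ws Tn !eqxx.
move=> fs; rewrite (basis_expansion f); apply: linspan_sum => S _.
apply: linspan_sum => mu _.
have [/and3P[/eqP zr /eqP ws /eqP Sn]|/fs ->] := boolP (in_degree r s n mu S).
  by apply: linspanZ_mem; exists mu, S.
by rewrite scale0r; exact: linspan0.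
Qed.

Lemma zexpDz mu i : zexp (mu + U_(lshift m i)) = (zexp mu + U_(i))%MM.
Proof.
by apply/mnmP => j; rewrite !(mnmE, mnmDE, mnm1E) (inj_eq (@lshift_inj _ _)).
Qed.

Lemma wexpDz mu i : wexp (mu + U_(lshift m i)) = wexp mu.
Proof. by apply/mnmP => j; rewrite !(mnmE, mnmDE, mnm1E) eq_lrshift addn0. Qed.

Lemma zexpDw mu i : zexp (mu + U_(rshift m i)) = zexp mu.
Proof. by apply/mnmP => j; rewrite !(mnmE, mnmDE, mnm1E) eq_rlshift addn0. Qed.

Lemma wexpDw mu i : wexp (mu + U_(rshift m i)) = (wexp mu + U_(i))%MM.
Proof.
by apply/mnmP => j; rewrite !(mnmE, mnmDE, mnm1E) (inj_eq (@rshift_inj _ _)).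
Qed.

(** An equality of booleans, so that it serves [Dq] in one direction and [Zop] in the other. Integer
    degrees avoid a case distinction at [r = 0]. *)
Lemma zstep_in_degree r s n mu S nu U : zstep mu S nu U ->
  in_degree (r - 1) s (n + 1) mu S = in_degree r s n nu U.
Proof.
move=> [i [iU -> ->]]; rewrite /in_degree zexpDz wexpDz mdegD mdeg1 cardsU1 iU.
by congr [&& _, _ & _]; apply/eqP/eqP; lia.
Qed.

Lemma wstep_in_degree r s n mu S nu U : wstep mu S nu U ->
  in_degree r (s - 1) (n - 1) mu S = in_degree r s n nu U.
Proof.
move=> [i [iS -> ->]]; rewrite /in_degree zexpDw wexpDw mdegD mdeg1 cardsU1 iS.
by congr [&& _, _ & _]; apply/eqP/eqP; lia.
Qed.

(** The lost power of [z_i] is compensated by the indicator of [i] in [S], so each summand of the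
    eigenvalue is unchanged. *)
Lemma zstep_eigA q mu S nu U : zstep mu S nu U ->
  eigA q nu U = eigA q mu S :> F.
Proof.
move=> [i [iU -> ->]]; apply: eq_bigr => j _; rewrite zexpDz mnmDE mnm1E !inE.
case: (eqVneq i j) => [<-|_]; first by rewrite (negbTE iU) addn0.
by rewrite addn0.
Qed.

(** Here the lost power of [w_i] is compensated because [i] leaves the set and the indicator enters
    with a minus sign. *)
Lemma wstep_eigB q mu S nu U : wstep mu S nu U ->
  eigB q nu U = eigB q mu S :> F.
Proof.
move=> [i [iS -> ->]]; apply: eq_bigr => j _; rewrite wexpDw mnmDE mnm1E !inE.
case: (eqVneq i j) => [<-|_]; first by rewrite (negbTE iS) addnK subn0.
by rewrite addn0.
Qed.

End Sector.

(** * Positivity of q-integers and eigenvalues for [0 < q < 1] *)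

Section Positivity.
Variables (C : numFieldType) (m : nat) (q : C).
Hypothesis q01 : 0 < q < 1.
Implicit Types (S U : {set 'I_m}) (mu nu : 'X_{1..(m + m)}).

Lemma qint_ge0 k : 0 <= qint q k.
Proof.
have /andP[q0 q1] := q01; apply: divr_ge0; last by rewrite subr_ge0 ltW.
by rewrite subr_ge0 exprn_ile1 ?ltW.
Qed.

Lemma qint_gt0 k : 0 < qint q k.+1.
Proof.
have /andP[q0 q1] := q01; apply: divr_gt0; last by rewrite subr_gt0.
by rewrite subr_gt0 exprn_ilt1 ?ltW.
Qed.

Lemma qfact_ge0 k : 0 <= qfact q k.
Proof. by apply: prodr_ge0 => i _; exact: qint_ge0. Qed.

Lemma eigA_ge0 mu S : 0 <= eigA q mu S.
Proof. by apply: sumr_ge0 => i _; exact: qint_ge0. Qed.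

Lemma eigB_ge0 mu S : 0 <= eigB q mu S.
Proof. by apply: sumr_ge0 => i _; exact: qint_ge0. Qed.

(** The index [i] of the step lies in [S], so its summand is the q-integer of a positive number; the
    others are nonnegative. *)
Lemma zstep_eigA_neq0 mu S nu U : zstep mu S nu U -> eigA q mu S != 0.
Proof.
move=> [i [_ -> _]]; rewrite /eigA (bigD1 i) //= gt_eqF // ltr_pwDl //.
  by rewrite !inE eqxx addn1 qint_gt0.
by apply: sumr_ge0 => j _; exact: qint_ge0.
Qed.

Lemma wstep_eigB_neq0 mu S nu U : wstep mu S nu U -> eigB q mu S != 0.
Proof.
move=> [i [iS _ _]]; rewrite /eigB (bigD1 i) //= gt_eqF // ltr_pwDl //.
  by rewrite (negbTE iS) subn0 addn1 qint_gt0.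
by apply: sumr_ge0 => j _; exact: qint_ge0.
Qed.

End Positivity.

(** * Hermitian symmetry of the Jackson-Fischer form and the adjoint pairs *)

Section Adjunction.
Variables (C : numClosedFieldType) (m : nat) (q : C).
Hypothesis q01 : 0 < q < 1.
Local Notation V := (pspace C m).
Implicit Types (f g : V) (S : {set 'I_m}) (mu : 'X_{1..(m + m)}).

Definition adjoint (T U : V -> V) : Prop :=
  forall f g, jf q (T f) g = jf q f (U g).

Lemma mqfactD n (a : 'X_{1..n}) i :
  mqfact q (a + U_(i)) = mqfact q a * qint q (a i).+1.
Proof.
rewrite /mqfact (bigD1 i) //= [in RHS](bigD1 i) //= mnmDE mnm1E eqxx addn1.
rewrite {1}/qfact big_nat_recr //= mulrAC; congr (_ * _ * _).
by apply: eq_bigr => j ji; rewrite mnmDE mnm1E eq_sym (negbTE ji) addn0.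
Qed.

(** The ratio of consecutive weights is exactly the factor in [mcoeff_qder]; this is what makes
    [mulX] and [qder] adjoint. *)
Lemma jf_weightD mu k :
  jf_weight q (mu + U_(k)) = jf_weight q mu * qint q (mu k).+1.
Proof.
rewrite /jf_weight; case: (split_ordP k) => i ->.
  by rewrite zexpDz wexpDz mqfactD mulrAC mnmE.
by rewrite zexpDw wexpDw mqfactD mulrA mnmE.
Qed.

Lemma conj_ge0 (x : C) : 0 <= x -> x^* = x.
Proof. by move=> x0; apply: conj_Creal; exact: ger0_real. Qed.

Lemma conj_jf_weight mu : (jf_weight q mu)^* = jf_weight q mu.
Proof.
apply: conj_ge0; apply: mulr_ge0;
  by apply: prodr_ge0 => i _; exact: qfact_ge0.
Qed.

(** [jf] sums over the support of its first argument only; comparing two such sums requires a common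
    range. *)
Lemma sum_msupp_widen n (p : {mpoly C[n]}) (s : seq 'X_{1..n})
    (F : 'X_{1..n} -> C) :
  uniq s -> {subset msupp p <= s} -> (forall nu, p@_nu = 0 -> F nu = 0) ->
  \sum_(nu <- msupp p) F nu = \sum_(nu <- s) F nu.
Proof.
move=> us sub F0; rewrite [RHS](bigID (fun nu => nu \in msupp p)) /=.
rewrite [X in _ = _ + X]big1 ?addr0 => [|nu]; last first.
  by rewrite mcoeff_msupp negbK => /eqP /F0.
rewrite -[RHS]big_filter; apply: perm_big.
apply: uniq_perm; rewrite ?filter_uniq ?msupp_uniq // => nu.
by rewrite mem_filter; apply/idP/andP => [h|[]//]; rewrite sub.
Qed.

(** Both sums are extended to the union of the supports, and the weights are real. Additivity in the
    first argument, where the range varies, is then deduced from the second, where it is fixed. *)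
Lemma jf_conj f g : (jf q f g)^* = jf q g f.
Proof.
rewrite /jf rmorph_sum; apply: eq_bigr => S _.
set s := undup (msupp (f S) ++ msupp (g S)).
rewrite (sum_msupp_widen (s := s)) ?undup_uniq //; first last.
- by move=> mu ->; rewrite mul0r mulr0.
- by move=> mu h; rewrite mem_undup mem_cat h.
rewrite [RHS](sum_msupp_widen (s := s)) ?undup_uniq //; first last.
- by move=> mu ->; rewrite mul0r mulr0.
- by move=> mu h; rewrite mem_undup mem_cat h orbT.
rewrite rmorph_sum; apply: eq_bigr => mu _ /=.
by rewrite rmorphM /= conj_jf_weight rmorphM /= conjCK [X in _ * X = _]mulrC.
Qed.

Lemma jfDr f g h : jf q f (g + h) = jf q f g + jf q f h.
Proof.
rewrite /jf -big_split; apply: eq_bigr => S _ /=; rewrite -big_split.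
by apply: eq_bigr => mu _ /=; rewrite ffunE mcoeffD rmorphD !mulrDr.
Qed.

Lemma jfNr f g : jf q f (- g) = - jf q f g.
Proof.
rewrite /jf -sumrN; apply: eq_bigr => S _ /=; rewrite -sumrN.
by apply: eq_bigr => mu _ /=; rewrite ffunE mcoeffN rmorphN !mulrN.
Qed.

Lemma jf0r f : jf q f 0 = 0.
Proof. by rewrite -(subrr f) jfDr jfNr subrr. Qed.

Lemma jf_sumr (I : Type) (s : seq I) f (g : I -> V) :
  jf q f (\sum_(i <- s) g i) = \sum_(i <- s) jf q f (g i).
Proof. exact: (big_morph _ (jfDr f) (jf0r f)). Qed.

Lemma jf0l g : jf q 0 g = 0.
Proof. by rewrite -jf_conj jf0r conjC0. Qed.

Lemma jfDl f g h : jf q (f + g) h = jf q f h + jf q g h.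
Proof. by rewrite -jf_conj jfDr rmorphD /= !jf_conj. Qed.

Lemma jfNl f g : jf q (- f) g = - jf q f g.
Proof. by rewrite -jf_conj jfNr rmorphN /= jf_conj. Qed.

Lemma jf_suml (I : Type) (s : seq I) (f : I -> V) g :
  jf q (\sum_(i <- s) f i) g = \sum_(i <- s) jf q (f i) g.
Proof. exact: (big_morph _ (fun x y => jfDl x y g) (jf0l g)). Qed.

Lemma adjoint_sym T U : adjoint T U -> adjoint U T.
Proof. by move=> TU f g; rewrite -jf_conj -TU jf_conj. Qed.

Lemma adjoint_sum (I : Type) (s : seq I) (T U : I -> V -> V) :
  (forall i, adjoint (T i) (U i)) ->
  adjoint (fun f => \sum_(i <- s) T i f) (fun f => \sum_(i <- s) U i f).
Proof.
by move=> TU f g; rewrite jf_suml jf_sumr; apply: eq_bigr => i _; exact: TU.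
Qed.

(** Multiplication by a variable shifts the support, so the sum can be reindexed over [msupp (f S)];
    the weight ratio then becomes the coefficient of [qder], which is real. *)
Lemma adjoint_mulX k : adjoint (pact (mulX k)) (pact (qder q k)).
Proof.
move=> f g; rewrite /jf; apply: eq_bigr => S _; rewrite !ffunE /mulX mulrC.
rewrite (perm_big _ (msuppMX _ _)) big_map /=; apply: eq_bigr => mu _.
rewrite [X in jf_weight q X]addmC jf_weightD -mulrA; congr (_ * _).
rewrite mcoeffMX mcoeff_qder rmorphM /= (conj_ge0 (qint_ge0 q01 _)).
by rewrite mulrCA [(U_(k) + mu)%MM]addmC.
Qed.

Lemma adjoint_Dq : adjoint (Dq q) (@Zop C m).
Proof.
apply: adjoint_sum => i f g; rewrite jf_ext ctr_mulX.
exact: (adjoint_sym (adjoint_mulX _)).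
Qed.

(** Proved from the side of [Zop_dag], since [jf_ext] moves [ext] out of the first argument. *)
Lemma adjoint_Dq_dag : adjoint (Dq_dag q) (@Zop_dag C m).
Proof.
apply: adjoint_sym; apply: adjoint_sum => i f g; rewrite jf_ext ctr_qder.
exact: adjoint_mulX.
Qed.

Lemma adjoint_diagop lam : (forall mu S, 0 <= lam mu S) ->
  adjoint (diagop lam) (diagop lam).
Proof.
move=> lam0 f g; rewrite /jf; apply: eq_bigr => S _.
(* The support shrinks where [lam] vanishes, so the range is first restored to that of [f S]. *)
rewrite (sum_msupp_widen (s := msupp (f S))) ?msupp_uniq //; first last.
- by move=> mu ->; rewrite mul0r mulr0.
- move=> mu; rewrite !mcoeff_msupp mcoeff_diagop.
  by apply: contra => /eqP ->; rewrite mulr0.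
apply: eq_bigr => mu _; rewrite !mcoeff_diagop rmorphM /= (conj_ge0 (lam0 _ _)).
by congr (_ * _); rewrite -mulrA mulrCA.
Qed.

End Adjunction.

(** * The projections in an abstract setting covering both the z-side and the w-side *)

Section HomotopyProjection.
Variables (C : numClosedFieldType) (m : nat) (q : C).
Hypothesis q01 : 0 < q < 1.
Local Notation V := (pspace C m).
Variables (D Z : {linear V -> V}) (lam : 'X_{1..(m + m)} -> {set 'I_m} -> C).
Variable step : 'X_{1..(m + m)} -> {set 'I_m} ->
  'X_{1..(m + m)} -> {set 'I_m} -> Prop.
Hypotheses (D_nilp : forall f, D (D f) = 0) (Z_nilp : forall f, Z (Z f) = 0).
Hypothesis homotopy : forall f, D (Z f) + Z (D f) = diagop lam f.
Hypotheses (Dstep : local step D) (Zstep : local (conv step) Z).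
Hypothesis lam_step : forall mu S nu U, step mu S nu U -> lam nu U = lam mu S.
Hypothesis lam_neq0 : forall mu S nu U, step mu S nu U -> lam mu S != 0.
Hypothesis lam_ge0 : forall mu S, 0 <= lam mu S.
Hypothesis adjDZ : adjoint q D Z.
Local Notation G := (diagop (fun mu S => (lam mu S)^-1)).
Implicit Types f g : V.

Definition projQ f := Z (G (D f)).
Definition projP f := f - projQ f.

Lemma D_pinv f : D (G f) = G (D f).
Proof. by apply: local_diagop_comm Dstep _ => mu S nu U /lam_step ->. Qed.

Lemma Z_pinv f : Z (G f) = G (Z f).
Proof. by apply: local_diagop_comm Zstep _ => mu S nu U /lam_step ->. Qed.

(** In the homotopy identity at [G (D f)] the term [Z (D (G (D f)))] vanishes, because [D] commutes
    with [G] and squares to zero; the diagonal part cancels [G] on the image of [D]. *)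
Lemma D_projQ f : D (projQ f) = D f.
Proof.
have := homotopy (G (D f)); rewrite D_pinv D_nilp !linear0 addr0 /projQ => ->.
exact: (local_diagopK _ Dstep lam_neq0).
Qed.

(** Write [Z f] as [Z (diagop lam (G f))], expand by the homotopy identity, drop the [Z (Z _)] term,
    and move [G] back past [Z] and [D]. *)
Lemma projQ_Z f : projQ (Z f) = Z f.
Proof.
have lam_neq0' mu S nu U : conv step mu S nu U -> lam mu S != 0.
  (* Invariance of [lam] carries its nonvanishing from the target of a step of [D] to the source. *)
  by move=> h; rewrite (lam_step h); exact: lam_neq0 h.
rewrite -[RHS](local_diagopK _ Zstep lam_neq0') -Z_pinv.
rewrite -(local_diagop_comm _ Zstep) => [|mu S nu U /lam_step -> //].
by rewrite -homotopy linearD /= Z_nilp addr0 Z_pinv D_pinv.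
Qed.

Lemma D_projP f : D (projP f) = 0.
Proof. by rewrite linearB /= D_projQ subrr. Qed.

Lemma projQ_ker f : D f = 0 -> projQ f = 0.
Proof. by rewrite /projQ => ->; rewrite !linear0. Qed.

Lemma projP_ker f : D f = 0 -> projP f = f.
Proof. by move=> Df; rewrite /projP projQ_ker // subr0. Qed.

Lemma projPQ_idempotents : complementary_idempotents projP projQ.
Proof.
have QQ f : projQ (projQ f) = projQ f by rewrite projQ_Z.
split=> f //.
- by rewrite projP_ker // D_projP.
- by rewrite /projP subrK.
- by rewrite /projP QQ subrr.
- by rewrite projQ_ker // D_projP.
Qed.

(** Taking adjoints reverses [Z G D] and exchanges [Z] with [D], while [G] is real diagonal. *)
Lemma projQ_selfadjoint : jf_selfadjoint q projQ.
Proof.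
move=> f g; rewrite /projQ (adjoint_sym q01 adjDZ) -adjDZ.
by apply: adjoint_diagop => mu S; rewrite invr_ge0.
Qed.

Lemma projP_selfadjoint : jf_selfadjoint q projP.
Proof.
move=> f g; rewrite /projP (jfDl q01) (jfNl q01) jfDr jfNr.
by rewrite projQ_selfadjoint.
Qed.

(** * Restriction to sectors: [D] maps [W] to [W'] and [Z] maps [W'] back to [W] *)

Section OnSector.
Variables p p' : 'X_{1..(m + m)} -> {set 'I_m} -> bool.
Hypothesis step_pp' : forall mu S nu U, step mu S nu U -> p' mu S = p nu U.
Local Notation W := (supported p : set V).
Local Notation W' := (supported p' : set V).

Lemma D_sector f : W f -> W' (D f).
Proof. by apply: local_supported Dstep _ => mu S nu U /step_pp' ->. Qed.

Lemma Z_sector f : W' f -> W (Z f).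
Proof. by apply: local_supported Zstep _ => mu S nu U /step_pp' ->. Qed.

Lemma projQ_sector f : W f -> W (projQ f).
Proof. by move=> Wf; apply/Z_sector/supported_diagop/D_sector. Qed.

Lemma projP_sector f : W f -> W (projP f).
Proof.
move=> Wf; rewrite /projP addrC -scaleN1r.
by apply: supported_lincomb => //; exact: projQ_sector.
Qed.

Lemma projP_image : projP @` W = kernel D `&` W.
Proof.
apply/seteqP; split=> [_ [f Wf <-]|f [Df Wf]].
  by split; [exact: D_projP|exact: projP_sector].
by exists f => //; exact: projP_ker.
Qed.

Lemma projQ_image : projQ @` W = Z @` W'.
Proof.
apply/seteqP; split=> _ [f Wf <-].
  by exists (G (D f)) => //; apply/supported_diagop/D_sector.
by exists (Z f); [exact: Z_sector|exact: projQ_Z].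
Qed.

Lemma sector_direct_sum :
  direct_sum W (kernel D `&` W) (Z @` (kernel D `&` W')).
Proof.
split; apply/seteqP; split.
- move=> f Wf; exists (projP f).
    by split; [exact: D_projP|exact: projP_sector].
  exists (projQ f); last by rewrite /projP subrK.
  (* The preimage under [Z] can be taken in the kernel of [D], as
     [D (G (D f)) = G (D (D f)) = 0]. *)
  exists (G (D f)) => //; split.
    by rewrite /kernel /= D_pinv D_nilp linear0.
  exact/supported_diagop/D_sector.
- move=> _ [f [_ Wf] [_ [g [_ Wg] <-] <-]].
  by rewrite -[f]scale1r; apply: supported_lincomb => //; exact: Z_sector.
(* A common element is fixed by [projQ], being in the image of [Z], and killed by it, being in the
   kernel of [D]. *)
- by move=> f [[Df _] [g _ e]]; rewrite /= -e -projQ_Z e projQ_ker.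
- move=> _ ->; split; first by split; [exact: linear0|exact: supported0].
  exists 0; last exact: linear0.
  by split; [exact: linear0|exact: supported0].
Qed.

Lemma sector_orthogonal :
  jf_orthogonal q (kernel D `&` W) (Z @` (kernel D `&` W')).
Proof.
by move=> f _ [Df _] [g _ <-]; rewrite -adjDZ Df (jf0l q01).
Qed.

End OnSector.
End HomotopyProjection.

(** * Specialization to the two pairs of operators over the complex numbers *)

Unset Implicit Arguments.
Set Strict Implicit.

Theorem theorem3p2 (R : realType) (m : nat) (q : R) :
  (1 <= m)%N -> 0 < q < 1 ->
  let qC : R[i] := q%:C in
  let P : int -> int -> int -> set (pspace R[i] m) := @sector R[i] m in
  let D := @Dq R[i] m qC in
  let Ddag := @Dq_dag R[i] m qC in
  let Z := @Zop R[i] m in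
  let Zdag := @Zop_dag R[i] m in
  let Piz := @Pz R[i] m qC in
  let Q_z := @Qz R[i] m qC in
  let Piw := @Pw R[i] m qC in
  let Q_w := @Qw R[i] m qC in
  [/\ complementary_idempotents Piz Q_z /\ complementary_idempotents Piw Q_w,
      forall r s n : int,
        [/\ Piz @` P r s n = kernel D `&` P r s n,
            Q_z @` P r s n = Z @` P (r - 1) s (n + 1),
            Piw @` P r s n = kernel Ddag `&` P r s n
          & Q_w @` P r s n = Zdag @` P r (s - 1) (n - 1)],
      forall r s n : nat, (n <= m)%N ->
        direct_sum (P r s n) (kernel D `&` P r s n)
          (Z @` (kernel D `&` P (r%:Z - 1) s (n%:Z + 1))) /\
        direct_sum (P r s n) (kernel Ddag `&` P r s n)
          (Zdag @` (kernel Ddag `&` P r (s%:Z - 1) (n%:Z - 1))),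
      forall r s n : nat, (n <= m)%N ->
        jf_orthogonal qC (kernel D `&` P r s n)
          (Z @` (kernel D `&` P (r%:Z - 1) s (n%:Z + 1))) /\
        jf_orthogonal qC (kernel Ddag `&` P r s n)
          (Zdag @` (kernel Ddag `&` P r (s%:Z - 1) (n%:Z - 1)))
    & [/\ jf_selfadjoint qC Piz, jf_selfadjoint qC Q_z,
          jf_selfadjoint qC Piw & jf_selfadjoint qC Q_w]].
Proof.
move=> _ q01 qC P D Ddag Z Zdag Piz Q_z Piw Q_w.
have qC01 : 0 < qC < 1 by rewrite !ltcR.
have two0 : (2%:R : R[i]) != 0 by rewrite pnatr_eq0.
have homA (f : pspace R[i] m) :
    Dq qC (Zop f) + Zop (Dq qC f) = diagop (eigA qC) f.
  exact: (Aq_diag qC f).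
have homB (f : pspace R[i] m) : Dq_dag qC (Zop_dag f) + Zop_dag (Dq_dag qC f) =
    diagop (eigB qC) f by exact: (Bq_diag qC f).
have sect (r s n : int) : P r s n = supported (in_degree r s n)
  by exact: sectorE.
have A0 := eigA_ge0 qC01 (m := m).
have B0 := eigB_ge0 qC01 (m := m).
have An0 := zstep_eigA_neq0 qC01 (m := m).
have Bn0 := wstep_eigB_neq0 qC01 (m := m).
have Dnil := @Dq_nilp _ m two0 qC.
have Ddnil := @Dq_dag_nilp _ m two0 qC.
have Znil := @Zop_nilp _ m two0.
have Zdnil := @Zop_dag_nilp _ m two0.
have DL := @local_Dq _ m qC.
have DdL := @local_Dq_dag _ m qC.
have ZL := @local_Zop R[i] m.
have ZdL := @local_Zop_dag R[i] m.
have Ainv := @zstep_eigA R[i] m qC.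
have Binv := @wstep_eigB R[i] m qC.
have adjz := @adjoint_Dq _ m _ qC01.
have adjw := @adjoint_Dq_dag _ m _ qC01.
have stz r s n := @zstep_in_degree m r s n.
have stw r s n := @wstep_in_degree m r s n.
split.
- split.
    (* [Pz] and [Qz] are convertible to [projP] and [projQ] with [lam] equal to [eigA qC]; likewise
       [Pw] and [Qw] with [eigB qC]. *)
    exact: (projPQ_idempotents Dnil Znil homA DL ZL Ainv An0).
  exact: (projPQ_idempotents Ddnil Zdnil homB DdL ZdL Binv Bn0).
- move=> r s n; rewrite !sect; split.
  + exact: (projP_image Dnil homA DL ZL Ainv An0 (stz r s n)).
  + exact: (projQ_image Znil homA DL ZL Ainv An0 (stz r s n)).
  + exact: (projP_image Ddnil homB DdL ZdL Binv Bn0 (stw r s n)).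
  + exact: (projQ_image Zdnil homB DdL ZdL Binv Bn0 (stw r s n)).
- move=> r s n _; rewrite !sect; split.
    exact: (sector_direct_sum Dnil Znil homA DL ZL Ainv An0 (stz r s n)).
  exact: (sector_direct_sum Ddnil Zdnil homB DdL ZdL Binv Bn0 (stw r s n)).
- move=> r s n _; rewrite !sect; split.
    exact: (sector_orthogonal qC01 adjz).
  exact: (sector_orthogonal qC01 adjw).
- split.
  + exact: (projP_selfadjoint qC01 A0 adjz).
  + exact: (projQ_selfadjoint qC01 A0 adjz).
  + exact: (projP_selfadjoint qC01 B0 adjw).
  + exact: (projQ_selfadjoint qC01 B0 adjw).
Qed.
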